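(* Let $n$ and $p$ be integers with $2 < p < n-1$. Then the distinguishing number of the $p$-th graph power $Q_n^p$ of the $n$-dimensional hypercube $Q_n$ is $2$, i.e. $D(Q_n^p) = 2$.
   Context: The $n$-dimensional hypercube $Q_n$ is the graph whose $2^n$ vertices are the binary strings $a_1\cdots a_n$ with $a_i\in\{0,1\}$, two vertices $v_1\cdots v_n$ and $w_1\cdots w_n$ being joined by an edge if and only if $|\{i : v_i\neq w_i\}| = 1$. For a graph $G$, the $p$-th power $G^p$ is the graph with $V(G^p)=V(G)$ and $E(G^p)=\{\{v,w\} : 0<d_G(v,w)\le p\}$, where $d_G(v,w)$ is the length of a shortest path between $v$ and $w$ in $G$. An $r$-coloring of a graph $G$ is any function $c\colon V(G)\to\{1,\dots,r\}$ (not required to be a proper coloring). An automorphism $\pi$ of $G$ preserves $c$ if $c(\pi v)=c(v)$ for every $v\in V(G)$. The coloring $c$ is distinguishing if no nontrivial automorphism of $G$ preserves it. The distinguishing number $D(G)$ is the smallest $r$ such that there exists a distinguishing $r$-coloring of $G$. *)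

(* Defs.v *)
From mathcomp Require Import all_boot all_fingroup.

Set Implicit Arguments.
Unset Strict Implicit.
Unset Printing Implicit Defensive.

Record sgraph := SGraph {
  vertex :> finType;
  adj : rel vertex;
  adj_sym : symmetric adj;
  adj_irrefl : irreflexive adj }.

Section Distance.
Variable G : sgraph.

Definition has_walk (k : nat) (v w : G) : bool :=
  [exists s : k.-tuple G, path (@adj G) v s && (last v s == w)].

(* Shortest paths have fewer than #|G| edges, so searching below #|G| is
   exhaustive. The value is #|G| (junk) when v and w are not connected. *)
Definition gdist (v w : G) : nat :=
  find (fun k => has_walk k v w) (iota 0 #|G|).

Lemma has_walkP k (v w : G) :
  reflect (exists s : seq G, [/\ size s = k, path (@adj G) v s & last v s = w])
          (has_walk k v w).
Proof.
apply: (iffP existsP) => [[s /andP[ps /eqP ls]]|[s [sz ps ls]]].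
  by exists s; rewrite size_tuple.
by move/eqP: sz => sz; exists (Tuple sz); rewrite /= ps ls eqxx.
Qed.

Lemma has_walk_sym k (v w : G) : has_walk k v w = has_walk k w v.
Proof.
suff sub x y : has_walk k x y -> has_walk k y x by apply/idP/idP; exact: sub.
case/has_walkP=> s [<- ps <-]; apply/has_walkP.
exists (rev (belast x s)); split; first by rewrite size_rev size_belast.
  by rewrite rev_path (eq_path (e' := @adj G)) // => a b; rewrite adj_sym.
by case: s {ps} => //= a s; rewrite rev_cons last_rcons.
Qed.

Lemma connect_has_walk (v w : G) :
  connect (@adj G) v w -> exists2 k, k < #|G| & has_walk k v w.
Proof.
case/connectP=> s ps ->; case/shortenP: ps => t pt ut _.
exists (size t); last by apply/has_walkP; exists t.
by rewrite -[_ < _]/(size (v :: t) <= _) -(card_uniqP ut) max_card.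
Qed.

Lemma gdistP (v w : G) : connect (@adj G) v w ->
  has_walk (gdist v w) v w /\ forall k, has_walk k v w -> gdist v w <= k.
Proof.
case/connect_has_walk=> k0 lt0 W0.
have hasW : has (fun k => has_walk k v w) (iota 0 #|G|).
  by apply/hasP; exists k0; rewrite ?mem_iota.
have ltd : gdist v w < #|G|.
  by rewrite /gdist; move: hasW; rewrite has_find size_iota.
split; first by move: (nth_find 0 hasW); rewrite nth_iota.
move=> k Wk; rewrite leqNgt; apply/negP => ltk.
by have := before_find 0 ltk; rewrite nth_iota ?(ltn_trans ltk) // add0n Wk.
Qed.

Lemma gdist_sym (v w : G) : gdist v w = gdist w v.
Proof. by apply: eq_find => k; exact: has_walk_sym. Qed.

Lemma gdistvv (v : G) : gdist v v = 0.
Proof.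
apply/eqP; rewrite -leqn0; apply: (gdistP (connect0 _ v)).2.
by apply/has_walkP; exists [::].
Qed.

End Distance.

Section Power.
Variables (G : sgraph) (p : nat).

(* Connectedness is required because gdist is a junk value otherwise. *)
Definition power_adj : rel G :=
  fun v w => connect (@adj G) v w && (0 < gdist v w <= p).

Lemma power_adj_sym : symmetric power_adj.
Proof.
move=> v w; rewrite /power_adj gdist_sym; congr (_ && _).
exact: (sym_connect_sym (@adj_sym G)).
Qed.

Lemma power_adj_irrefl : irreflexive power_adj.
Proof. by move=> v; rewrite /power_adj gdistvv andbF. Qed.

Definition graph_power : sgraph := SGraph power_adj_sym power_adj_irrefl.

End Power.

Section Hypercube.
Variable n : nat.

Definition cube_adj : rel (n.-tuple bool) :=
  fun v w => #|[set i : 'I_n | tnth v i != tnth w i]| == 1.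

Lemma cube_adj_sym : symmetric cube_adj.
Proof.
by move=> v w; congr (#|pred_of_set _| == 1);
   apply/setP => i; rewrite !inE eq_sym.
Qed.

Lemma cube_adj_irrefl : irreflexive cube_adj.
Proof.
move=> v; rewrite /cube_adj (_ : [set i | _] = set0) ?cards0 //.
by apply/setP => i; rewrite !inE eqxx.
Qed.

Definition hypercube : sgraph := SGraph cube_adj_sym cube_adj_irrefl.

End Hypercube.

Section Distinguishing.
Variable G : sgraph.

Definition automorphism (f : {perm G}) : bool :=
  [forall v : G, forall w : G, adj (f v) (f w) == adj v w].

Definition preserves (r : nat) (f : {perm G}) (c : {ffun G -> 'I_r}) : bool :=
  [forall v : G, c (f v) == c v].

Definition distinguishing (r : nat) (c : {ffun G -> 'I_r}) : bool :=
  [forall f : {perm G}, automorphism f && preserves f c ==> (f == 1%g)].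

Definition distinguishable (r : nat) : bool :=
  [exists c : {ffun G -> 'I_r}, distinguishing c].

Lemma ex_distinguishable : exists r, distinguishable r.
Proof.
exists #|G|; apply/existsP; exists [ffun v => enum_rank v].
apply/forallP => f; apply/implyP => /andP[_ /forallP fix_c].
apply/eqP/permP => v; rewrite perm1; apply: enum_rank_inj.
by move/eqP: (fix_c v); rewrite !ffunE.
Qed.

Definition distinguishing_number : nat := ex_minn ex_distinguishable.

End Distinguishing.

(* Main.v *)
Require Import Defs.
From mathcomp Require Import all_boot all_fingroup.
From mathcomp Require Import zify.

(** Encode the vertices of Q_n as subsets of [n]; adjacency in Q_n^p is then
    Hamming distance between 1 and p.

    Let N(d) be the number of vertices in the intersection of two balls of
    radius p whose centres are at distance d. Then N is nonincreasing,
    N(1) = N(2) by parity, and N(2) > N(3) because 0 < p < n-1. So an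
    automorphism of Q_n^p preserves the relation "at distance at most 2",
    whatever the parity of p, and it suffices to find a set of black vertices
    that breaks all symmetries of Q_n^2.

    The neighbours of the empty set in Q_n^2, namely the singletons and the
    pairs, form the line graph of K_{n+1} (the singleton {i} being the edge from
    i to an extra vertex oo). Colour black the empty set and the edges of an
    asymmetric graph on [n] and oo: a path 1-2-...-(n-1) together with the edges
    from oo to 0, 1 and 2. The empty set is the only black vertex within
    distance 2 of all the others, so it is fixed; the line graph of the
    asymmetric graph is rigid, so all black vertices are fixed; this fixes all
    singletons, and then all subsets by induction on the cardinality. *)

Set Implicit Arguments.
Unset Strict Implicit.
Unset Printing Implicit Defensive.

(** * Hamming distance on subsets, and flips of one element *)

Section Hamming.
Variable T : finType.
Implicit Types (X Y Z W : {set T}) (i j : T).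

Definition hamming X Y := #|[set i | (i \in X) != (i \in Y)]|.

Definition flip i X := [set j | (j \in X) (+) (j == i)].

Lemma hammingC X Y : hamming X Y = hamming Y X.
Proof. by apply: eq_card => i; rewrite !inE eq_sym. Qed.

Lemma hamming_eq0 X Y : (hamming X Y == 0) = (X == Y).
Proof.
rewrite cards_eq0; apply/eqP/eqP => [/setP d0 | ->].
  by apply/setP => i; have := d0 i; rewrite !inE => /negbFE/eqP.
by apply/setP => i; rewrite !inE eqxx.
Qed.

Lemma hammingXX X : hamming X X = 0.
Proof. by apply/eqP; rewrite hamming_eq0. Qed.

Lemma hamming_triangle Y X Z : hamming X Z <= hamming X Y + hamming Y Z.
Proof.
apply: leq_trans (leq_card_setU _ _); apply/subset_leq_card/subsetP => i.
by rewrite !inE; do 3!case: (i \in _).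
Qed.

Lemma flipK i : involutive (flip i).
Proof. by move=> X; apply/setP => j; rewrite !inE -addbA addbb addbF. Qed.

Lemma mem_flip i X : (i \in flip i X) = (i \notin X).
Proof. by rewrite inE eqxx addbT. Qed.

(** The two booleans are complementary: they tell a step away from [X] from a step towards it,
    without truncated subtraction. *)
Lemma hamming_flip i X Y :
  hamming X (flip i Y) + ((i \in X) != (i \in Y))
  = hamming X Y + ((i \in X) == (i \in Y)).
Proof.
rewrite /hamming (cardsD1 i) (cardsD1 i [set j | (j \in X) != (j \in Y)]).
rewrite !inE eqxx addbT.
rewrite (_ : [set j | _] :\ i = [set j | (j \in X) != (j \in Y)] :\ i).
  by do 2!case: (i \in _) => /=; lia.
by apply/setP => j; rewrite !inE; case: eqP => //= _; rewrite addbF.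
Qed.

Lemma hamming_flip_same i X Y :
  (i \in X) = (i \in Y) -> hamming X (flip i Y) = (hamming X Y).+1.
Proof. by move=> e; have := hamming_flip i X Y; rewrite e eqxx; lia. Qed.

Lemma hamming_flip_diff i X Y :
  (i \in X) != (i \in Y) -> (hamming X (flip i Y)).+1 = hamming X Y.
Proof. by move=> e; have := hamming_flip i X Y; rewrite e (negbTE e) /=; lia. Qed.

Lemma hamming_flip2 i X Y : hamming (flip i X) (flip i Y) = hamming X Y.
Proof.
by apply: eq_card => j; rewrite !inE; do 2!case: (j \in _); case: (j == i).
Qed.

(** One step of a geodesic from [Y] to [X]. The membership equality lets [common_flip] apply to [Y]
    seen as [flip i (flip i Y)]. *)
Lemma hamming_gt0_flip X Y : 0 < hamming X Y ->
  exists i, (i \in X) = (i \in flip i Y)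
    /\ hamming X Y = (hamming X (flip i Y)).+1.
Proof.
rewrite card_gt0 => /set0Pn[i]; rewrite inE => ne; exists i.
rewrite (hamming_flip_diff ne) mem_flip; split=> //.
by move: ne; do 2!case: (i \in _).
Qed.

(** * Common points of two balls of radius [p] *)

Section Common.
Variable p : nat.

Definition common X Y := #|[set W | (hamming X W <= p) && (hamming Y W <= p)]|.

(* Pair each [W] agreeing with [X] at [i] with [flip i W]: writing [a], [b] for
   the distances from [W] to [X] and [Y], the pair contributes
   [a <= p][b <= p] + [a < p][b < p] on the left and
   [a <= p][b < p] + [a < p][b <= p] in the first term on the right. *)
Lemma common_flip i X Y : (i \in X) = (i \in Y) ->
  common X Y = common X (flip i Y)
    + #|[set W : {set T} | [&& (i \in W) == (i \in X), hamming X W == p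
                             & hamming Y W == p]]|.
Proof.
move=> XY.
have count (P : pred {set T}) : #|[set W | P W]|
    = \sum_(W : {set T} | (i \in W) == (i \in X)) (P W + P (flip i W)).
  rewrite -sum1dep_card big_mkcond /= big_split /=.
  rewrite (bigID [pred W : {set T} | (i \in W) == (i \in X)]) /=; congr (_ + _).
  rewrite (reindex_inj (inv_inj (flipK i))) /=; apply: eq_big => [W|W _].
    by rewrite mem_flip; do 2!case: (i \in _).
  by case: (P _).
rewrite /common !count -big_split /=.
apply: eq_bigr => W /eqP WX.
have XW: (i \in X) = (i \in W) by [].
have YW: (i \in Y) = (i \in W) by rewrite -XY.
rewrite hamming_flip2 !(hamming_flip_same XW, hamming_flip_same YW).
rewrite (hammingC (flip i Y) W) (hamming_flip_same (esym YW)) (hammingC W).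
rewrite mem_flip WX eqxx; case: (i \in X) => /=; lia.
Qed.

Lemma common_flip_le i X Y : (i \in X) = (i \in Y) ->
  common X (flip i Y) <= common X Y.
Proof. by move/common_flip->; exact: leq_addr. Qed.

Lemma hamming1_flip X Y : hamming X Y = 1 -> exists i, Y = flip i X.
Proof.
move=> d1; have [|i [_]] := @hamming_gt0_flip X Y; first by rewrite d1.
rewrite d1 => -[/esym/eqP]; rewrite hamming_eq0 => /eqP->.
by exists i; rewrite flipK.
Qed.

(** Parity: the distances from any [W] to [X] and to [Y] differ by exactly 1, so they are not both
    [p] and the correction term of [common_flip] vanishes. *)
Lemma common_flip_dist1 i X Y : (i \in X) = (i \in Y) -> hamming X Y = 1 ->
  common X (flip i Y) = common X Y.
Proof.
move=> XY /hamming1_flip[j eY].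
rewrite (common_flip XY) [X in _ + X](_ : _ = 0) ?addn0 //.
apply/eqP; rewrite cards_eq0 -subset0; apply/subsetP => W; rewrite inE eY.
case/and3P=> _ /eqP dX /eqP dY; have := hamming_flip j W X.
by rewrite !(hammingC W) dX dY; case: eqP => /=; lia.
Qed.

(** For distinct [i] and [j], both counts equal the one for [X] and [flip i (flip j X)], at distance
    2. *)
Lemma common_flip1 i j X : common X (flip i X) = common X (flip j X).
Proof.
have [->//|ij] := eqVneq i j.
have d1 k : hamming X (flip k X) = 1 by rewrite hamming_flip_same ?hammingXX.
rewrite -(@common_flip_dist1 j _ (flip i X)) //; last first.
  by rewrite inE eq_sym (negbTE ij) addbF.
rewrite -(@common_flip_dist1 i _ (flip j X)) //; last first.
  by rewrite inE (negbTE ij) addbF.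
by congr common; apply/setP => k; rewrite !inE addbAC.
Qed.

(** Along a geodesic from [Y] to [X] the count never decreases; by [common_flip1] it does not matter
    through which neighbour of [X] the geodesic ends. *)
Lemma common_le_flip i X Y : X != Y -> common X Y <= common X (flip i X).
Proof.
move dY: (hamming X Y) => d; elim: d Y dY => [|d IHd] Y dY.
  by move/eqP: dY; rewrite hamming_eq0 => ->.
move=> _; have [|j [jX dj]] := @hamming_gt0_flip X Y; first by rewrite dY.
have [E|ne] := eqVneq X (flip j Y).
  by rewrite (common_flip1 i j) (_ : Y = flip j X) // E flipK.
apply: leq_trans (IHd _ _ ne); last by move: dj; rewrite dY => -[].
by rewrite -{1}(flipK j Y); exact: common_flip_le.
Qed.

Lemma common_dist2 X Y Z : X != Y -> hamming X Y <= 2 -> X != Z ->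
  common X Z <= common X Y.
Proof.
move=> XY d2 XZ; rewrite -hamming_eq0 in XY.
have [|j [jX dj]] := @hamming_gt0_flip X Y; first by lia.
apply: leq_trans (common_le_flip j XZ) _.
have [d1|d1] : hamming X (flip j Y) = 0 \/ hamming X (flip j Y) = 1 by lia.
  by move/eqP: d1; rewrite hamming_eq0 => /eqP {2}->; rewrite flipK.
rewrite -{1}(flipK j Y) (@common_flip_dist1 j X (flip j Y)) //.
by have [k ->] := hamming1_flip d1; rewrite (common_flip1 j k).
Qed.

Hypotheses (p_gt0 : 0 < p) (ltpT : p.+1 < #|T|).

(** N(2) > N(3): the correction term of [common_flip] is positive, as some [W] agreeing with [X] at
    [i] is at distance exactly [p] from both [X] and [Y]. *)
Lemma common_flip_lt i X Y : (i \in X) = (i \in Y) -> hamming X Y = 2 ->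
  common X (flip i Y) < common X Y.
Proof.
move=> XY d2; rewrite (common_flip XY) -[X in X < _]addn0 ltn_add2l card_gt0.
have /cards2P[j [k [jk eD]]] : #|[set l | (l \in X) != (l \in Y)]| == 2 by apply/eqP.
have iD : i \notin [set j; k] by rewrite -eD inE XY eqxx.
(* Room for [p.-1] elements besides [i], [j], [k]: this is the bound [p.+1 < #|T|]. *)
have cS : p.-1 <= #|~: [set i; j; k]|.
  have := cardsC [set i; j; k]; rewrite -setUA cardsU1 iD cards2 jk; lia.
have [P] : exists P : {set T}, (P \subset ~: [set i; j; k]) && (#|P| == p.-1).
  have : 0 < #|[set P : {set T} | P \subset ~: [set i; j; k] & #|P| == p.-1]|.
    by rewrite cards_draws bin_gt0.
  by rewrite card_gt0 => /set0Pn[P]; rewrite inE; exists P.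
case/andP=> /subsetP sP /eqP cP.
have [Pi Pj Pk] : [/\ i \notin P, j \notin P & k \notin P].
  by split; apply/negP => /sP; rewrite !inE eqxx ?orbT.
have cU l : l \notin P -> #|l |: P| = p by move=> lP; rewrite cardsU1 lP cP; lia.
(* This set differs from [X] on [j |: P] and from [Y] on [k |: P]. *)
apply/set0Pn; exists [set l | (l \in X) (+) (l \in j |: P)].
have [ij ik] : i != j /\ i != k by apply/andP; move: iD; rewrite !inE negb_or.
have YE l : (l \in Y) = (l \in X) (+) (l \in [set j; k]).
  by rewrite -eD inE; do 2!case: (l \in _).
rewrite !inE (negbTE ij) (negbTE Pi) addbF eqxx /=.
apply/andP; split; apply/eqP.
  rewrite -[RHS](cU j Pj).
  by apply: eq_card => l; rewrite !inE; case: (l \in X); case: (_ || _).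
rewrite -[RHS](cU k Pk).
apply: eq_card => l; rewrite !inE YE !inE.
have [->|lj] := eqVneq l j.
  by rewrite (negbTE jk) (negbTE Pj); case: (j \in X).
have [->|lk] := eqVneq l k; first by rewrite (negbTE Pk); case: (k \in X).
by case: (l \in X); case: (l \in P).
Qed.

(** [Z] is the point at distance 2 from [X] on a geodesic from [Y] to [X]. *)
Lemma common_lt_dist3 X Y : 2 < hamming X Y ->
  exists2 Z, X != Z & common X Y < common X Z.
Proof.
move dY: (hamming X Y) => d; elim: d Y dY => // d IHd Y dY d_gt2.
have [|i [iX di]] := @hamming_gt0_flip X Y; first by rewrite dY.
have dZ : hamming X (flip i Y) = d by move: di; rewrite dY => -[].
have [d2|d3] := eqVneq d 2.
  exists (flip i Y); first by rewrite -hamming_eq0 dZ d2.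
  by rewrite -{1}(flipK i Y) common_flip_lt // dZ.
have [||Z XZ lt] := IHd (flip i Y); [by [] | by lia |].
exists Z => //; apply: leq_ltn_trans lt.
by rewrite -{1}(flipK i Y) common_flip_le.
Qed.

(** Describes distance at most 2 through balls of radius [p] alone, hence in terms that a bijection
    preserving distance at most [p] respects. *)
Lemma hamming_le2P X Y : X != Y ->
  reflect (forall Z, X != Z -> common X Z <= common X Y) (hamming X Y <= 2).
Proof.
move=> XY; apply: (iffP idP) => [d2 Z|maxY]; first exact: common_dist2.
rewrite leqNgt; apply/negP => /common_lt_dist3[Z /maxY].
by rewrite leqNgt => /negP.
Qed.

Lemma hamming_le2_morph (f : {set T} -> {set T}) : injective f ->
    (forall X Y, (hamming (f X) (f Y) <= p) = (hamming X Y <= p)) ->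
  forall X Y, (hamming (f X) (f Y) <= 2) = (hamming X Y <= 2).
Proof.
move=> inj_f fp X Y; have [->|XY] := eqVneq X Y; first by rewrite !hammingXX.
have [g fK gK] := injF_bij inj_f.
have common_f Z Z' : common (f Z) (f Z') = common Z Z'.
  rewrite /common -[RHS](card_imset _ inj_f); apply: eq_card => W.
  by rewrite -[W]gK (mem_imset _ _ inj_f) !inE !fp.
have fXY : f X != f Y by rewrite (inj_eq inj_f).
apply/(hamming_le2P fXY)/(hamming_le2P XY) => maxY Z XZ.
  by rewrite -(common_f X Z) -(common_f X Y) maxY // (inj_eq inj_f).
by rewrite -(gK Z) !common_f maxY // -(inj_eq inj_f) gK.
Qed.

End Common.
End Hamming.

(** * Distances through cardinalities *)

Lemma hamming_setI (T : finType) (X Y : {set T}) :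
  hamming X Y + (#|X :&: Y|).*2 = #|X| + #|Y|.
Proof.
rewrite -(cardsID Y X) -(cardsID X Y) (setIC Y X).
suff -> : hamming X Y = #|X :\: Y| + #|Y :\: X| by lia.
rewrite -cardsUI [X in _ = _ + X](_ : _ = 0) ?addn0; last first.
  apply/eqP; rewrite cards_eq0; apply/eqP/setP => i; rewrite !inE.
  by do 2!case: (i \in _).
by apply: eq_card => i; rewrite !inE; do 2!case: (i \in _).
Qed.

Lemma hamming0X (T : finType) (X : {set T}) : hamming set0 X = #|X|.
Proof. by have := hamming_setI set0 X; rewrite set0I cards0 addn0. Qed.

Lemma hamming_set1 (T : finType) (a : T) (X : {set T}) :
  hamming [set a] X + (a \in X).*2 = #|X|.+1.
Proof.
have := hamming_setI [set a] X; rewrite cards1 add1n => <-; congr (_ + _.*2).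
case: (boolP (a \in X)) => aX.
  by rewrite (setIidPl _) ?cards1 // sub1set.
by apply/esym/eqP; rewrite cards_eq0 setI_eq0 disjoints1.
Qed.

Lemma hamming_set1_le2 (T : finType) (a : T) (X : {set T}) :
  (hamming [set a] X <= 2) = (#|X| <= if a \in X then 3 else 1).
Proof. by have := hamming_set1 a X; case: (a \in X); lia. Qed.

(** * Rigidity of the line graph *)

(* The adjacency (or equality) relation of the line graph of the asymmetric
   graph, in the indexing of [marker] below: a path 0-1-2-... with the three
   chords 02, 13 and 24. *)
Definition chord j k := (k == j.+1) || (k == j.+2) && (j < 3).

Definition close j k := [|| j == k, chord j k | chord k j].

(** Vertices are recognised in turn: 2 by its degree, {0,...,4} as the closed neighbourhood of 2, 4
    as the end of the only edge leaving that set, then 3, 1 and 0 by their adjacencies, and the rest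
    along the path. *)
Lemma close_rigid n (g : nat -> nat) : 4 < n ->
    (forall j k, j <= n -> k <= n -> close (g j) (g k) = close j k) ->
    (forall j k, j <= n -> k <= n -> g j = g k -> j = k) ->
  forall k, k <= n -> g k = k.
Proof.
rewrite /close /chord => n4 gC gI.
have I := fun j k (a : j <= 5) (b : k <= 5) =>
  gI j k (leq_trans a n4) (leq_trans b n4).
have C := fun j k (a : j <= 5) (b : k <= 5) =>
  gC j k (leq_trans a n4) (leq_trans b n4).
(* For [z != 2], these three values include all neighbours of [z]. *)
pose nbrs z := [:: z.+1; if z == 0 then 2 else z.-1;
                   if z == 1 then 3 else if z == 3 then 1 else 2].
have nb z w : z != 2 -> w != z -> [|| z == w, chord z w | chord w z] ->
    w \in nbrs z.
  by rewrite /chord !inE; case: z => [|[|[|[|z]]]] /=; lia.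
have gne j k : j <= 5 -> k <= 5 -> j != k -> g j != g k.
  by move=> j5 k5; apply: contra_neq; exact: I.
(* 2 is the only vertex of degree 4. *)
have g2 : g 2 = 2.
  apply/eqP/negPn/negP => z2.
  suff : size [:: g 0; g 1; g 3; g 4] <= size (nbrs (g 2)) by [].
  apply: uniq_leq_size; last first.
    move=> w wG; apply: (nb _ _ z2); move: wG; rewrite !inE => /or4P[] /eqP->;
      by rewrite ?C ?gne.
  by rewrite /= !inE !negb_or !gne.
have le4 j : j <= n -> (g j <= 4) = (j <= 4).
  have nb2 w : [|| 2 == w, chord 2 w | chord w 2] = (w <= 4).
    by rewrite /chord; lia.
  by move=> jn; rewrite -!nb2 -[in LHS]g2 gC // (leq_trans _ n4).
have g4 : g 4 = 4.
  have := C 4 5 isT isT; have := le4 4 (ltnW n4); have := le4 5 n4.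
  by rewrite /chord /=; lia.
have g3 : g 3 = 3.
  have := C 3 4 isT isT; have := gne 3 2 isT isT isT; have := gne 3 4 isT isT isT.
  have := le4 3 (leq_trans _ n4) => /(_ isT).
  by rewrite g2 g4 /chord /=; lia.
have g1 : g 1 = 1.
  have := C 1 3 isT isT; have := C 1 4 isT isT; have := gne 1 3 isT isT isT.
  by rewrite g3 g4 /chord /=; lia.
have g0 : g 0 = 0.
  have := C 0 2 isT isT; have := C 0 3 isT isT; have := gne 0 2 isT isT isT.
  by rewrite g2 g3 /chord /=; lia.
elim/ltn_ind => k IHk kn.
case: k IHk kn => [|[|[|[|[|k]]]]] // IHk kn.
have gk4 : g k.+4 = k.+4 by apply: IHk; lia.
have gk3 : g k.+3 = k.+3 by apply: IHk; lia.
have k4n : k.+4 <= n by lia.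
have := gC k.+4 k.+4.+1 k4n kn; have := le4 _ kn.
have : g k.+4.+1 != k.+3 by rewrite -gk3; apply/eqP => /gI; lia.
have : g k.+4.+1 != k.+4 by rewrite -gk4; apply/eqP => /gI; lia.
by rewrite gk4 /chord; lia.
Qed.

(** * Rigidity of the coloured square of the hypercube *)

Section Rigidity.
Variable n : nat.
Hypothesis n_gt4 : 4 < n.

(* {0}, {1}, {2}, and then {k-2, k-1} for 3 <= k <= n. *)
Definition marker k : {set 'I_n} :=
  [set i : 'I_n | if k < 3 then k == i else (k == i.+1) || (k == i.+2)].

Definition markers := [seq marker k | k <- iota 0 n.+1].

Lemma markersP X : reflect (exists2 k, k <= n & X = marker k) (X \in markers).
Proof.
apply: (iffP mapP) => [[k]|[k kn ->]]; first by rewrite mem_iota; exists k.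
by exists k; rewrite // mem_iota.
Qed.

Lemma marker1 (a : 'I_n) : a < 3 -> marker a = [set a].
Proof. by move=> a3; apply/setP => i; rewrite !inE a3 -val_eqE eq_sym. Qed.

Lemma card_marker k : k <= n -> #|marker k| = (2 < k).+1.
Proof.
case: (ltnP k 3) => k3 kn.
  have kn' : k < n by lia.
  by rewrite (marker1 (a := Ordinal kn')) // cards1; lia.
have [k1 k2] : k.-1 < n /\ k.-2 < n by lia.
rewrite (_ : marker k = [set Ordinal k1; Ordinal k2]).
  by rewrite cards2 -val_eqE /=; lia.
by apply/setP => i; rewrite !inE -!val_eqE ltnNge k3 /=; lia.
Qed.

(** Two distinct edges at oo share only oo, which is not an element of any marker; hence the
    separate case of two singletons. *)
Lemma marker_meet j k : j <= n -> k <= n ->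
  (0 < #|marker j :&: marker k|) =
  if (j < 3) && (k < 3) then j == k else close j k.
Proof.
move=> jn kn; rewrite card_gt0 /close /chord; apply/set0Pn/idP => [[i]|].
  by rewrite !inE; case: (ltnP j 3); case: (ltnP k 3) => /=; lia.
pose i := if j < 3 then j else if k < 3 then k else (minn j k).-1.
have lt_i : i < n by rewrite /i; case: (ltnP j 3); case: (ltnP k 3); lia.
move=> meet; exists (Ordinal lt_i); rewrite !inE /= {lt_i}/i; move: meet.
by case: (ltnP j 3); case: (ltnP k 3) => /=; lia.
Qed.

(** Two sets of one or two elements are within distance 2 iff they meet or are both singletons, that
    is, iff the edges they encode share an endpoint. *)
Lemma marker_close j k : j <= n -> k <= n ->
  (hamming (marker j) (marker k) <= 2) = close j k.
Proof.
move=> jn kn; have := hamming_setI (marker j) (marker k).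
have := marker_meet jn kn; rewrite !card_marker // /close /chord.
by case: (ltnP j 3); case: (ltnP k 3) => /=; lia.
Qed.

Lemma marker_inj j k : j <= n -> k <= n -> marker j = marker k -> j = k.
Proof.
move=> jn kn E.
have mem i (lt_i : i < n) := congr1 (fun A : {set _} => Ordinal lt_i \in A) E.
have := card_marker jn; rewrite E card_marker // => -[].
have [j3|j3] := ltnP j 3; have [k3|k3] //= := ltnP k 3 => _.
  have lt_j : j < n by lia.
  by have := mem j lt_j; rewrite !inE j3 k3 /= eqxx => /esym/eqP.
have [lt1 lt2] : j.-1 < n /\ j.-2 < n by lia.
have := mem _ lt1; have := mem _ lt2.
by rewrite !inE (ltnNge j 3) (ltnNge k 3) j3 k3 /=; lia.
Qed.

Variable f : {set 'I_n} -> {set 'I_n}.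
Hypothesis inj_f : injective f.
Hypothesis f2 : forall X Y, (hamming (f X) (f Y) <= 2) = (hamming X Y <= 2).
Hypothesis f_black : forall X, (f X \in set0 :: markers) = (X \in set0 :: markers).

Lemma fix_set0 : f set0 = set0.
Proof.
have [g fK gK] := injF_bij inj_f.
have near0 k : k <= n -> hamming (f set0) (marker k) <= 2.
  move=> kn; rewrite -(gK (marker k)) f2.
  have : g (marker k) \in set0 :: markers.
    by rewrite -f_black gK inE; apply/orP; right; apply/markersP; exists k.
  rewrite inE => /predU1P[->|/markersP[j jn ->]]; first by rewrite hammingXX.
  by rewrite hamming0X card_marker //; case: (2 < j).
have : f set0 \in set0 :: markers by rewrite f_black mem_head.
rewrite inE => /predU1P[//|/markersP[j jn E]].
(* Indices close to 0 are at most 2, and those close to 5 are at least 4. *)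
have := near0 0 isT; have := near0 5 n_gt4.
by rewrite E !marker_close // /close /chord; lia.
Qed.

Lemma fix_marker k : k <= n -> f (marker k) = marker k.
Proof.
(* The action of [f] on the indices of the markers, to which [close_rigid] applies. *)
move=> kn; pose g j := index (f (marker j)) markers.
have gP j : j <= n -> g j <= n /\ f (marker j) = marker (g j).
  move=> jn.
  have : f (marker j) \in set0 :: markers.
    by rewrite f_black inE; apply/orP; right; apply/markersP; exists j.
  rewrite inE => /predU1P[|mj].
    rewrite -fix_set0 => /inj_f/eqP.
    by rewrite -cards_eq0 card_marker.
  have lt_g : g j < n.+1 by rewrite -index_mem size_map size_iota in mj.
  split=> //; rewrite -[LHS](nth_index set0 mj) (nth_map 0) ?size_iota //.
  by rewrite nth_iota.
rewrite (gP k kn).2; congr marker.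
apply: (close_rigid n_gt4) => // [i j iN jN|i j iN jN E].
  by rewrite -!marker_close ?(gP _ _).1 // -(gP _ iN).2 -(gP _ jN).2 f2 marker_close.
by apply: marker_inj => //; apply: inj_f; rewrite (gP _ iN).2 (gP _ jN).2 E.
Qed.

(* If [f [set x]] had two elements, it would have to contain 0, 1 and 2. *)
Lemma fix_set1 x : f [set x] = [set x].
Proof.
have [x3|x3] := ltnP x 3; first by rewrite -marker1 // fix_marker // ltnW.
have near_k k : k <= n -> (hamming (f [set x]) (marker k) <= 2)
    = (hamming [set x] (marker k) <= 2).
  by move=> kn; rewrite -{1}(fix_marker kn) f2.
have Y_gt0 : 0 < #|f [set x]|.
  rewrite card_gt0; apply/eqP; rewrite -fix_set0 => /inj_f/eqP.
  by rewrite -cards_eq0 cards1.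
have Y_le2 : #|f [set x]| <= 2.
  by rewrite -hamming0X -fix_set0 f2 hamming0X cards1.
have [y Yy] : exists y, f [set x] = [set y].
  apply/cards1P; apply: contraT => c1.
  have mem_Y (a : 'I_n) : a < 3 -> a \in f [set x].
    move=> a3; have := near_k a (ltnW (ltn_ord a)).
    rewrite marker1 // !(hammingC _ [set a]).
    rewrite !hamming_set1_le2 cards1; case: (a \in f _) => //.
    case: ifP => _ Y1; by rewrite eqn_leq Y1 Y_gt0 in c1.
  have [l0 l1 l2] : [/\ 0 < n, 1 < n & 2 < n] by split; lia.
  have : [set Ordinal l0; Ordinal l1; Ordinal l2] \subset f [set x].
    by rewrite !subUset !sub1set !mem_Y.
  move/subset_leq_card/leq_trans/(_ Y_le2).
  by rewrite setUC cardsU1 cards2 !inE -!val_eqE.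
rewrite Yy; congr [set _]; apply: val_inj => /=.
have y3 : 3 <= y.
  rewrite leqNgt; apply/negP => y3; have lt_y := ltnW (ltn_ord y).
  have /set1_inj xy : [set x] = [set y].
    by apply: inj_f; rewrite Yy -(marker1 y3) (fix_marker lt_y).
  by rewrite ltnNge -ltnS xy y3 in x3.
have xy k : 2 < k -> k <= n ->
    (k == x.+1) || (k == x.+2) = (k == y.+1) || (k == y.+2).
  move=> k3 kn; have := near_k k kn.
  rewrite Yy !hamming_set1_le2 card_marker // k3 !inE (ltnNge k 3) k3 /=.
  by do 2!case: (_ || _).
(* Index [x.+1] leaves [x = y] or [x = y.+1]; index [x] excludes the latter. *)
have := xy x.+1 (leqW x3) (ltn_ord x); rewrite eqxx => /esym/orP[]/eqP[]// E.
by have := xy x x3 (ltnW (ltn_ord x)); rewrite E eqxx; lia.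
Qed.

(** From two elements on, a set is recovered from its distances to its subsets with one or two
    elements fewer, which are fixed by induction. *)
Lemma rigidity : f =1 id.
Proof.
move=> X; elim: {X}_.+1 {-2}X (ltnSn #|X|) => // w IHw X.
rewrite ltnS leq_eqVlt => /predU1P[cX|/IHw//].
case: w => [|[|w]] in IHw cX *.
- by move/eqP: cX; rewrite cards_eq0 => /eqP->; exact: fix_set0.
- by move/eqP/cards1P: cX => [x ->]; exact: fix_set1.
(* Smaller sets are their own images, so by injectivity [f X] is not one of them. *)
have cY : w.+1 < #|f X|.
  rewrite ltnNge; apply/negP => le_w; have /inj_f E := IHw _ le_w.
  by rewrite E cX ltnn in le_w.
have near_X (Z : {set 'I_n}) : Z \subset X -> #|Z| < w.+2 -> hamming X Z <= 2 ->
    hamming Z (f X) <= 2.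
  by move=> ZX cZ; rewrite -{2}(IHw Z) // f2 hammingC.
have card_near (Z : {set 'I_n}) : Z \subset X -> hamming X Z = #|X| - #|Z|.
  move=> ZX; have := hamming_setI X Z; rewrite (setIidPr ZX).
  by have := subset_leq_card ZX; lia.
have X1 i : i \in X -> #|X :\ i| = w.+1.
  by move=> iX; have := cardsD1 i X; rewrite iX cX; lia.
have other k : exists2 i, i \in X & i != k.
  have : 0 < #|X :\ k| by have := cardsD1 k X; lia.
  by case/card_gt0P => i; rewrite !inE => /andP[]; exists i.
have Y_le : #|f X| <= w.+2.
  (* Removing two elements of [X] leaves a fixed set of size [w] within distance 2 of [f X]. *)
  have [i iX _] := other (Ordinal (ltn_trans (ltn0Sn 3) n_gt4)).
  have [j jX ji] := other i.
  have ZX : X :\ i :\ j \subset X by rewrite !subDset !subsetU ?subxx ?orbT.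
  have cZ : #|X :\ i :\ j| = w.
    by have := cardsD1 j (X :\ i); rewrite X1 // !inE ji jX; lia.
  have := hamming_setI (X :\ i :\ j) (f X); rewrite cZ.
  have : hamming (X :\ i :\ j) (f X) <= 2.
    by apply: near_X; rewrite ?card_near // cZ ?cX; lia.
  have := subset_leq_card (subsetIl (X :\ i :\ j) (f X)); rewrite cZ; lia.
apply/esym/eqP; rewrite eqEcard cX Y_le andbT; apply/subsetP => k kX.
have [i iX ik] := other k; have ZX := subsetDl X [set i].
suff : X :\ i \subset f X by move/subsetP; apply; rewrite !inE eq_sym ik.
(* The sizes [w.+1] and [w.+2] have opposite parities, so the distance is 1 and [X :\ i] lies inside
   [f X]. *)
have := hamming_setI (X :\ i) (f X); rewrite X1 //.
have : hamming (X :\ i) (f X) <= 2.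
  by apply: near_X; rewrite ?card_near // X1 // ?cX; lia.
move=> h2 hI; apply/setIidPl/eqP.
by rewrite eqEcard subsetIl X1 //; lia.
Qed.

End Rigidity.

(** * Powers of the hypercube in terms of supports *)

Section Cube.
Variable n : nat.
Implicit Types (v w : hypercube n) (X Y : {set 'I_n}).

Definition supp v : {set 'I_n} := [set i | tnth v i].
Definition char X : hypercube n := [tuple i \in X | i < n].

Lemma suppK : cancel supp char.
Proof. by move=> v; apply: eq_from_tnth => i; rewrite tnth_mktuple inE. Qed.

Lemma charK : cancel char supp.
Proof. by move=> X; apply/setP => i; rewrite inE tnth_mktuple. Qed.

Lemma adj_hamming v w : cube_adj v w = (hamming (supp v) (supp w) == 1).
Proof.
by rewrite /hamming; congr (_ == _); apply: eq_card => i; rewrite !inE.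
Qed.

Lemma walk_hamming k v w : has_walk k v w -> hamming (supp v) (supp w) <= k.
Proof.
case/has_walkP=> s [<-{k}]; elim: s v => [|u s IHs] v /=.
  by move=> _ ->; rewrite hammingXX.
case/andP; rewrite adj_hamming => /eqP vu /IHs h /h{}h.
by apply: leq_trans (hamming_triangle (supp u) _ _) _; rewrite vu add1n ltnS.
Qed.

Lemma has_walk_hamming v w : has_walk (hamming (supp v) (supp w)) v w.
Proof.
apply/has_walkP; move dE: (hamming _ _) => d.
elim: d v dE => [|d IHd] v dE.
  move/eqP: dE; rewrite hamming_eq0 => /eqP/(can_inj suppK)->.
  by exists [::].
have [|i [iw di]] := @hamming_gt0_flip _ (supp w) (supp v).
  by rewrite hammingC dE.
have [|s [sz ps ls]] := IHd (char (flip i (supp v))).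
  by rewrite charK hammingC; move: di; rewrite hammingC dE => -[].
exists (char (flip i (supp v)) :: s); split; rewrite /= ?sz ?ps ?andbT //.
by rewrite adj_hamming charK hamming_flip_same ?hammingXX.
Qed.

Lemma gdist_hamming v w :
  connect (@adj (hypercube n)) v w /\ gdist v w = hamming (supp v) (supp w).
Proof.
have vw : connect (@adj (hypercube n)) v w.
  by apply/connectP; have /has_walkP[s [_ ps ls]] := has_walk_hamming v w; exists s.
split=> //; have [W min] := gdistP vw.
by apply/eqP; rewrite eqn_leq walk_hamming // min // has_walk_hamming.
Qed.

Lemma adj_power p v w :
  @adj (graph_power (hypercube n) p) v w = (0 < hamming (supp v) (supp w) <= p).
Proof. by rewrite /= /power_adj; have [-> ->] := gdist_hamming v w. Qed.

(** The positivity condition in adjacency only says that the vertices are distinct, which every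
    permutation preserves. *)
Lemma automorphism_hamming p (f : {perm graph_power (hypercube n) p}) :
  reflect (forall v w, (hamming (supp (f v)) (supp (f w)) <= p)
                       = (hamming (supp v) (supp w) <= p))
          (automorphism f).
Proof.
apply: (iffP forallP) => [aut v w|aut v].
  have [->|vw] := eqVneq v w; first by rewrite !hammingXX.
  have /eqP := forallP (aut v) w; rewrite !adj_power !lt0n !hamming_eq0.
  by rewrite !(inj_eq (can_inj suppK)) (inj_eq perm_inj) vw.
apply/forallP => w; rewrite !adj_power !lt0n !hamming_eq0 aut.
by rewrite !(inj_eq (can_inj suppK)) (inj_eq perm_inj).
Qed.

Definition complement v : hypercube n := char (~: supp v).

Lemma complementK : involutive complement.
Proof. by move=> v; rewrite /complement charK setCK suppK. Qed.

(** Complementation preserves all Hamming distances; it serves to rule out a single colour. *)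
Lemma automorphism_complement p :
  automorphism (G := graph_power (hypercube n) p) (perm (inv_inj complementK)).
Proof.
apply/automorphism_hamming => v w; rewrite !permE !charK; congr (_ <= _).
by apply: eq_card => i; rewrite !inE; do 2!case: (tnth _ i).
Qed.

End Cube.

Theorem corollary2p2 (n p : nat) (hp : 2 < p) (hpn : p < n - 1) :
  distinguishing_number (graph_power (hypercube n) p) = 2.
Proof.
pose G := graph_power (hypercube n) p.
have n_gt4 : 4 < n by lia.
rewrite /distinguishing_number; case: ex_minnP => r /existsP[c dist_c] min_r.
apply/eqP; rewrite eqn_leq min_r /=; last first.
  pose black := set0 :: markers n.
  apply/existsP; exists [ffun v : G => inord (supp v \in black)].
  apply/forallP => f; apply/implyP => /andP[/automorphism_hamming aut /forallP fc].
  have inj_F : injective (fun X => supp (f (char X))).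
    move=> X Y /(can_inj (@suppK n))/perm_inj; exact: (can_inj (@charK n)).
  apply/eqP/permP => v; rewrite perm1; apply: (can_inj (@suppK n)).
  rewrite -{1}[v](@suppK n).
  (* [rigidity] is applied to [f] transported to subsets of ['I_n]. *)
  apply: (rigidity n_gt4 inj_F) => [|X].
    apply: (@hamming_le2_morph _ p) => // [||X Y]; rewrite ?card_ord; try lia.
    by rewrite aut !charK.
  have inord_bool (b : bool) : @inord 1 b = b :> nat by rewrite inordK //; case: b.
  have /eqP/(congr1 val) := fc (char X); rewrite !ffunE charK /= !inord_bool.
  by case: (supp _ \in _); case: (X \in _).
rewrite ltnNge; apply/negP => r_le1.
pose f : {perm G} := perm (inv_inj (@complementK n)).
have f_c : preserves f c.
  (* Colours are smaller than [r <= 1], so the colouring is constant. *)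
  have c0 u : c u = 0 :> nat.
    by apply/eqP; rewrite -leqn0 -ltnS (leq_trans (ltn_ord _) r_le1).
  by apply/forallP => v; apply/eqP/val_inj; rewrite /= !c0.
have lt0 : 0 < n by lia.
have := implyP (forallP dist_c f); rewrite automorphism_complement f_c.
(* Complementation moves the empty set, as coordinate 0 shows. *)
move=> /(_ isT)/eqP/permP/(_ (char set0))/(congr1 (@supp n))/setP/(_ (Ordinal lt0)).
by rewrite permE perm1 !charK !inE.
Qed.
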